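(* Let $\alpha$ be an ordinal. Then there exists a cop-win graph $G$ such that $\rho(G)=\alpha$, i.e. the maximum capture time of $G$ is $\alpha$.
   Context: The game of cops and robbers on a graph $G$: the cop picks a starting vertex, then the robber picks one; then they alternate moves, the cop moving first, each move consisting of moving to an adjacent vertex or staying put. The cop wins if he lands on the robber's vertex. $G$ is cop-win if the cop has a winning strategy. For a vertex $v$, $N[v]$ denotes the closed neighbourhood ($v$ together with its neighbours). Relations $\leq_\alpha$ on $V(G)$, for ordinals $\alpha$ (for a graph of cardinality $\aleph_\beta$, for $\alpha<\omega_{\beta+1}$): $u\leq_0 v$ iff $u=v$; and $u\leq_\alpha v$ if for every $x\in N[u]$ there exists $y\in N[v]$ such that $x\leq_{\delta} y$ for some $\delta<\alpha$. Define $\eta(u,v)$ as the minimum ordinal $\alpha$ with $u\leq_\alpha v$; $\eta(v)$ as the minimum ordinal $\alpha$ such that $u\leq_\alpha v$ for all $u\in V(G)$; and $\rho(G)=\sup_{v\in V(G)}\eta(v)$, the maximum capture time. *)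

(* Defs.v *)
From mathcomp Require Import all_boot.

Set Implicit Arguments.
Unset Strict Implicit.
Unset Printing Implicit Defensive.

(* Ordinals are represented by well-ordered types. Two of them denote the same
   ordinal when they are isomorphic ([ord_eq]), so "the" ordinals below are
   given by predicates that are invariant under isomorphism. *)
Record Ord := MkOrd {
  ord_sort :> Type;
  below : ord_sort -> ord_sort -> Prop;
  below_trans : forall x y z, below x y -> below y z -> below x z;
  below_total : forall x y, [\/ below x y, x = y | below y x];
  below_wf : well_founded below }.

Definition increasing (a b : Ord) (f : a -> b) : Prop :=
  forall x y : a, below x y -> below (f x) (f y).

Definition ord_eq (a b : Ord) : Prop :=
  exists f : a -> b, increasing f /\ forall z : b, exists x : a, f x = z.

(* [a] is isomorphic to the initial segment of [b] below some [y : b]. *)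
Definition ord_lt (a b : Ord) : Prop :=
  exists (y : b) (f : a -> b),
    increasing f /\ forall z : b, below z y <-> exists x : a, f x = z.

Definition ord_le (a b : Ord) : Prop := ord_lt a b \/ ord_eq a b.

Definition ord_is_zero (a : Ord) : Prop := a -> False.

Record graph := MkGraph {
  vertex :> Type;
  adj : vertex -> vertex -> Prop;
  adj_sym : forall x y, adj x y -> adj y x;
  adj_irr : forall x, ~ adj x x }.

Definition Ncl (G : graph) (v x : G) : Prop := x = v \/ adj v x.

(* A strategy of the cop maps the list [:: r 0; ...; r (n - 1)] of the
   positions shown so far by the robber to the n-th position of the cop; on the
   empty list it gives the starting vertex. The cop's own past positions are
   determined by the strategy, hence are not arguments of it. *)
Definition cop_play (G : graph) (s : seq G -> G) (r : nat -> G) (n : nat) : G :=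
  s (mkseq r n).

(* The cop's move from [cop_play s r n] to [cop_play s r n.+1] is made when the
   robber is on [r n]. *)
Definition winning_cop_strategy (G : graph) (s : seq G -> G) : Prop :=
  forall r : nat -> G, (forall n, Ncl (r n) (r n.+1)) ->
    (forall n, Ncl (cop_play s r n) (cop_play s r n.+1)) /\
    exists n, cop_play s r n.+1 = r n.

Definition cop_win (G : graph) : Prop :=
  exists s : seq G -> G, winning_cop_strategy s.

(* The second clause is void when [a] is zero, since [u] is in N[u]; hence at
   zero the relation is equality. *)
Inductive rel_le (G : graph) : Ord -> G -> G -> Prop :=
| rel_le_zero (a : Ord) (u : G) : ord_is_zero a -> rel_le a u u
| rel_le_step (a : Ord) (u v : G) :
    (forall x : G, Ncl u x ->
       exists y : G, Ncl v y /\ exists d : Ord, ord_lt d a /\ rel_le d x y) ->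
    rel_le a u v.

(* eta(v) = a *)
Definition is_eta (G : graph) (v : G) (a : Ord) : Prop :=
  (forall u : G, rel_le a u v) /\
  forall b : Ord, (forall u : G, rel_le b u v) -> ord_le a b.

(* rho(G) = a; this includes that eta(v) is defined for every vertex v. *)
Definition is_rho (G : graph) (a : Ord) : Prop :=
  [/\ forall v : G, exists b : Ord, is_eta v b,
      forall (v : G) (b : Ord), is_eta v b -> ord_le b a
    & forall c : Ord, (forall (v : G) (b : Ord), is_eta v b -> ord_le b c) ->
        ord_le a c].

(* Main.v *)
Require Import Defs.
From mathcomp Require Import all_boot zify.
From Stdlib Require Import Classical ClassicalEpsilon Inverse_Image.

(* Write alpha = lambda + n with lambda zero or a limit. For lambda = 0 a path on
   n + 1 vertices works. For lambda a limit, the robber lives on a forest whose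
   nodes have ranks below lambda, and the cop on a clique of guards, the guard
   of x being adjacent to x and to the parent of x. Chased by the guard of his
   node the robber can only move to a child, so his rank decreases; since there
   are two children of every smaller rank, the cop cannot do better. As the cop
   reaches every guard from every guard, all capture times are at most lambda. A
   path with vertices 0, ..., n hung on one further guard raises the capture
   time to exactly lambda + n at its end: the robber waits at that guard until
   the cop stands next to him, and only then chooses the rank of his first
   node. *)

Set Implicit Arguments.
Unset Strict Implicit.
Unset Printing Implicit Defensive.

(** * Well-orders *)

Lemma below_irr (a : Ord) (x : a) : ~ below x x.
Proof. by elim/(well_founded_ind (@below_wf a)): x => x IH H; apply: (IH x H H). Qed.

Lemma exists_minimal (a : Ord) (P : a -> Prop) :
  (exists x, P x) -> exists x, P x /\ forall y, below y x -> ~ P y.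
Proof.
move=> [x Px]; apply: NNPP => H.
elim/(well_founded_ind (@below_wf a)): x Px => x IH Px.
by apply: H; exists x; split=> // y yx Py; apply: (IH y).
Qed.

(** [ord_lt a b] unfolds to the existence of such a [y]; with [y] named, elements of one fixed
    well-order can stand for the ordinals below it. *)
Definition iso_seg (a b : Ord) (y : b) : Prop :=
  exists f : a -> b, increasing f /\ forall z : b, below z y <-> exists x : a, f x = z.

Lemma increasing_reflects (a b : Ord) (f : a -> b) (x y : a) :
  increasing f -> below (f x) (f y) -> below x y.
Proof.
move=> fi H; case: (below_total x y) => // [xy|/fi yx].
  by move: H; rewrite xy => /below_irr.
by case: (below_irr (below_trans H yx)).
Qed.

Lemma iso_seg_trans (d a b : Ord) (x : a) (y : b) (f : a -> b) :
  increasing f -> (forall z : b, below z y <-> exists x : a, f x = z) ->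
  iso_seg d x -> iso_seg d (f x).
Proof.
move=> fi fy [g [gi gx]]; exists (f \o g); split=> [u v /gi /fi //|z]; split.
  move=> zfx.
  have /fy [w wz] : below z y by apply: below_trans zfx _; apply/fy; exists x.
  have /gx [u uw] : below w x by apply: increasing_reflects fi _; rewrite wz.
  by exists u; rewrite /= uw.
by move=> [u <-] /=; apply: fi; apply/gx; exists u.
Qed.

Lemma iso_seg_eq (d a b : Ord) (y : b) : ord_eq d a -> iso_seg a y -> iso_seg d y.
Proof.
move=> [g [gi gs]] [f [fi fy]]; exists (f \o g); split=> [u v /gi /fi //|z].
split=> [/fy [x <-]|[u <-]]; first by have [u <-] := gs x; exists u.
by apply/fy; exists (g u).
Qed.

Lemma iso_seg_lt (d a b : Ord) (y : b) :
  ord_lt d a -> iso_seg a y -> exists2 z, below z y & iso_seg d z.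
Proof.
move=> [x dx] [f [fi fy]]; exists (f x); first by apply/fy; exists x.
exact: iso_seg_trans fi fy dx.
Qed.

Section Segment.
Variables (b : Ord) (y : b).

Let seg_sort := {x : b | below x y}.
Let seg_below (u v : seg_sort) := below (sval u) (sval v).

Let seg_trans u v w : seg_below u v -> seg_below v w -> seg_below u w.
Proof. exact: below_trans. Qed.

Let seg_total u v : [\/ seg_below u v, u = v | seg_below v u].
Proof.
case: u v => [u uy] [v vy]; rewrite /seg_below /=.
case: (below_total u v) => [H|H|H]; [exact: Or31| |exact: Or33].
by apply: Or32; move: vy; rewrite -H => vy; rewrite (proof_irrelevance _ uy vy).
Qed.

Let seg_wf : well_founded seg_below.
Proof. exact: (wf_inverse_image _ _ _ sval (@below_wf b)). Qed.

Definition seg : Ord := MkOrd seg_trans seg_total seg_wf.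

Lemma iso_seg_seg : iso_seg seg y.
Proof.
exists (fun u : seg => sval u); split=> [u v //|z].
split=> [zy|[[u uy] <-] //]; by exists (exist _ z zy).
Qed.

End Segment.

Lemma iso_seg_below (a b : Ord) (y z : b) :
  iso_seg a y -> below z y -> exists2 d, ord_lt d a & iso_seg d z.
Proof.
move=> [f [fi fy]] /fy [x <-]; exists (seg x).
  by exists x; exact: iso_seg_seg.
exact: iso_seg_trans fi fy (iso_seg_seg x).
Qed.

(** Back-and-forth form of the statement that the segments below [x] and [y] are isomorphic; no map
    between them has to be carried along. *)
Inductive match_elt (a b : Ord) (x : a) (y : b) : Prop :=
  MatchElt of (forall x', below x' x -> exists2 y', below y' y & match_elt x' y')
            & (forall y', below y' y -> exists2 x', below x' x & match_elt x' y').

Lemma match_elt_sym (a b : Ord) (x : a) (y : b) : match_elt x y -> match_elt y x.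
Proof.
elim/(well_founded_ind (@below_wf a)): x y => x IH y [H1 H2].
split=> z zb; [have [w ? ?] := H2 z zb|have [w ? ?] := H1 z zb]; exists w => //;
  exact: IH.
Qed.

Lemma match_elt_fun (a b : Ord) (x : a) (y y' : b) :
  match_elt x y -> match_elt x y' -> y = y'.
Proof.
elim/(well_founded_ind (@below_wf a)): x y y'.
have aux (x : a) (y y' : b) :
    (forall x', below x' x -> forall u v : b,
       match_elt x' u -> match_elt x' v -> u = v) ->
    match_elt x y -> match_elt x y' -> ~ below y y'.
  move=> IH [H1 _] [_ H2] yy'; have [x' x'x m] := H2 y yy'.
  have [y'' y''y m'] := H1 x' x'x.
  by move: y''y; rewrite (IH x' x'x y'' y m' m) => /below_irr.
move=> x IH y y' m m'; case: (below_total y y') => // H.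
  by case: (aux x y y').
by case: (aux x y' y).
Qed.

Lemma match_elt_mono (a b : Ord) (x x' : a) (y y' : b) :
  match_elt x y -> match_elt x' y' -> below x x' -> below y y'.
Proof. by move=> m [H _] /H [z zy' m']; rewrite (match_elt_fun m m'). Qed.

(** The matching is an increasing map with downward closed image: either it is onto, or the least
    missed element bounds the image. *)
Lemma total_match_le (a b : Ord) :
  (forall x : a, exists y : b, match_elt x y) -> ord_le a b.
Proof.
move=> /choice [f fm].
have fi : increasing f by move=> x y; apply: match_elt_mono.
have fd x y : below y (f x) -> exists x', f x' = y.
  have [_ H] := fm x => /H [x' _ m]; exists x'; exact: match_elt_fun (fm x') m.
case: (classic (forall z, exists x, f x = z)) =>
    [fs|/not_all_ex_not /exists_minimal [y [ny ym]]].
  by right; exists f.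
left; exists y, f; split=> // z; split=> [/ym /NNPP //|[x <-]].
case: (below_total (f x) y) => // [H|/fd //].
by case: ny; exists x.
Qed.

Lemma ord_le_or_lt (a b : Ord) : ord_le a b \/ ord_lt b a.
Proof.
case: (classic (forall x : a, exists y : b, match_elt x y)) =>
    [/total_match_le|]; first by left.
move/not_all_ex_not/exists_minimal => [x [nx xm]]; right.
have bm (y : b) : exists x' : a, match_elt x' y.
  apply: NNPP => nm.
  have {y nm} [y [ny ym]] :=
    exists_minimal (ex_intro (fun y : b => ~ exists x : a, match_elt x y) y nm).
  (* The least unmatched elements [x] and [y] would match each other. *)
  apply: (nx); exists y; split=> [x' x'x|y' y'y].
    have [y' m] := NNPP _ (xm x' x'x); exists y' => //.
    case: (below_total y' y) => // [E|yy'].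
      by case: ny; exists x'; rewrite -E.
    by have [_ /(_ _ yy') [x'' _ m']] := m; case: ny; exists x''.
  have [x' m] := NNPP _ (ym y' y'y); exists x' => //.
  case: (below_total x' x) => // [E|xx'].
    by case: nx; exists y'; rewrite -E.
  by have [/(_ _ xx') [y'' _ m'] _] := m; case: nx; exists y''.
have [g gm] := choice _ bm.
have gm' y := match_elt_sym (gm y).
exists x, g; split=> [y y'|z]; first exact: match_elt_mono.
split=> [/xm /NNPP [y m]|[y <-]].
  by exists y; apply: match_elt_fun (gm' y) (match_elt_sym m).
case: (below_total (g y) x) => // [E|xg].
  by case: nx; exists y; rewrite -E.
by have [/(_ _ xg) [y' _ m] _] := gm y; case: nx; exists y'.
Qed.

(** * Capture within a level of a well-order *)

(** [rel_le] with its ordinal replaced by an element of a fixed well-order, so that arguments run by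
    induction in [B]. Admitting equality at every level agrees with [rel_le] by [rel_le_refl]. *)
Inductive capt (B : Ord) (G : graph) (t : B) (u v : G) : Prop :=
| capt_eq of u = v
| capt_step of
    forall x, Ncl u x -> exists y t', [/\ Ncl v y, below t' t & capt t' x y].

Lemma Ncl_refl (G : graph) (v : G) : Ncl v v.
Proof. by left. Qed.

Lemma capt_mono (B : Ord) (G : graph) (t s : B) (u v : G) :
  below t s -> capt t u v -> capt s u v.
Proof.
move=> ts [E|H]; first exact: capt_eq.
apply: capt_step => x /H [y [t' [? t't ?]]]; exists y, t'; split=> //.
exact: below_trans t't ts.
Qed.

Lemma rel_le_refl (G : graph) (a : Ord) (u : G) : rel_le a u u.
Proof.
(* The induction needs the ordinal as an element of a well-order; a nonempty [a] is reduced
   afterwards to one of its own segments. *)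
have aux (B : Ord) (t : B) : forall a u, iso_seg a t -> rel_le a u (u : G).
  elim/(well_founded_ind (@below_wf B)): t => t IH d w dt.
  case: (classic (exists z, below z t)) => [[z zt]|nz].
    apply: rel_le_step => x wx; exists x; split=> //.
    by have [e ed ez] := iso_seg_below dt zt; exists e; split=> //; apply: IH ez.
  apply: rel_le_zero => x; have [f [_ ft]] := dt.
  by apply: nz; exists (f x); apply/ft; exists x.
case: (classic (inhabited a)) => [[x]|na]; last by apply: rel_le_zero => x; apply: na.
apply: rel_le_step => y uy; exists y; split=> //; exists (seg x).
by split; [exists x|apply: (aux a x)]; exact: iso_seg_seg.
Qed.

Lemma rel_leP (B : Ord) (G : graph) (t : B) (a : Ord) (u v : G) :
  iso_seg a t -> rel_le a u v <-> capt t u v.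
Proof.
elim/(well_founded_ind (@below_wf B)): t a u v => t IH a u v at_; split.
  move=> r; case: r at_ => {a u v} [a u _ _|a u v H at_]; first exact: capt_eq.
  apply: capt_step => x /H [y [vy [d [da r]]]].
  have [t' t't dt'] := iso_seg_lt da at_; exists y, t'; split=> //.
  by apply/(IH t' t't d).
case=> [->|H]; first exact: rel_le_refl.
apply: rel_le_step => x /H [y [t' [vy t't c]]]; exists y; split=> //.
by have [d da dt'] := iso_seg_below at_ t't; exists d; split=> //; apply/(IH t').
Qed.

(** * Successor and limit elements *)

Definition is_successor (B : Ord) (t s : B) : Prop :=
  below t s /\ forall r, below r s -> ~ below t r.

Definition is_limit_or_zero (B : Ord) (l : B) : Prop :=
  forall t, below t l -> exists2 s, below t s & below s l.

(** Passing to predecessors stops after finitely many steps by well-foundedness. *)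
Lemma successor_decomposition (B : Ord) (t : B) :
  exists (z : nat -> B) (n : nat),
    [/\ z n = t, is_limit_or_zero (z 0)
      & forall k, k < n -> is_successor (z k) (z k.+1)].
Proof.
elim/(well_founded_ind (@below_wf B)): t => t IH.
case: (classic (is_limit_or_zero t)) => [tl|/not_all_ex_not [s H]].
  by exists (fun=> t), 0.
have [st sn] := imply_to_and _ _ H.
have [z [n [zn z0 zS]]] := IH s st.
exists (fun k => if k <= n then z k else t), n.+1; split=> [|//|k kn1].
  by rewrite ltnn.
have /orP[/eqP ->|kn] : (k == n) || (k < n) by rewrite -leq_eqVlt.
  rewrite leqnn ltnn zn; split=> // r rt sr; apply: sn; by exists r.
by rewrite (ltnW kn) kn; apply: zS.
Qed.

Lemma below_successor (B : Ord) (t s r q : B) :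
  is_successor t s -> below r s -> below q r -> below q t.
Proof.
move=> [_ H] rs qr; case: (below_total r t) => [rt|<- //|/(H r rs) //].
exact: below_trans qr rt.
Qed.

Lemma limit_chain (B : Ord) (l t0 : B) :
  is_limit_or_zero l -> below t0 l ->
  exists w : nat -> B, forall i, below (w i) (w i.+1) /\ below (w i) l.
Proof.
move=> ll t0l.
have /choice [f fP] (t : B) : exists s, below t l -> below t s /\ below s l.
  case: (classic (below t l)) => [/ll [s ? ?]|?]; by [exists s|exists t].
exists (fun i => iter i f t0) => i.
have H : below (iter i f t0) l by elim: i => //= i /fP [].
by split=> //; have [] := fP _ H.
Qed.

Lemma capt_mono_seq (B : Ord) (G : graph) (n : nat) (z : nat -> B) (i : nat) (u v : G) :
  (forall k, k < n -> below (z k) (z k.+1)) -> i <= n ->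
  capt (z i) u v -> capt (z n) u v.
Proof.
move=> + + c; elim: n => [|n IH] z_incr; first by rewrite leqn0 => /eqP <-.
rewrite leq_eqVlt => /orP[/eqP <- //|le_in].
by apply: capt_mono (z_incr n _) (IH _ le_in) => // k kn; apply/z_incr/leqW.
Qed.

(** * Pursuit along a path that meets the rest of the graph only at [p 0] *)

Section PathInGraph.
Variables (B : Ord) (G : graph) (n : nat) (p : nat -> G) (z : nat -> B).
Hypothesis p_nbr : forall j x, 0 < j <= n -> Ncl (p j) x ->
  exists2 j', j.-1 <= j' <= n & x = p j'.

(** The cop walks towards [p n] with the robber ahead of him; a robber who steps back onto the cop's
    vertex is caught, so [i] moves suffice. *)
Lemma path_chase :
  (forall i, i < n -> Ncl (p i) (p i.+1)) ->
  (forall i, i < n -> below (z i) (z i.+1)) ->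
  forall i j, i <= n -> n - i <= j <= n -> capt (z i) (p j) (p (n - i)).
Proof.
move=> p_step z_incr; elim=> [|i IH] j lein /andP[h1 h2].
  rewrite subn0 in h1 *; apply: capt_eq; congr p.
  by apply/eqP; rewrite eqn_leq h2 h1.
have nE : n - i = (n - i.+1).+1 by rewrite subnSK.
case: (ltngtP (n - i.+1) j) h1 => // [h1 _|-> _]; last exact: capt_eq.
have j0 : 0 < j by apply: leq_ltn_trans h1.
apply: capt_step => x /p_nbr [|j' /andP[h3 h4] ->]; first by rewrite j0.
have : n - i.+1 <= j' by apply: leq_trans h3; rewrite -ltnS prednK.
rewrite leq_eqVlt => /orP[/eqP E|h5].
  exists (p j'), (z i); rewrite -E; split; [exact: Ncl_refl|exact: z_incr|exact: capt_eq].
exists (p (n - i)), (z i); split; last by apply: IH; rewrite ?(ltnW lein) // nE h5.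
  by rewrite nE; apply: p_step; rewrite -nE leq_subr.
exact: z_incr.
Qed.

(* The robber waits at [a] until the cop has walked down to [p 0]. *)
Lemma path_delay (a : G) :
  (forall k, k < n -> is_successor (z k) (z k.+1)) ->
  (forall k, 0 < k <= n -> a <> p k) ->
  (forall t, below t (z 0) -> ~ capt t a (p 0)) ->
  forall t, below t (z n) -> ~ capt t a (p n).
Proof.
move=> z_succ ap base t.
(* Each round lowers [i] by one, down to 0, and [k] by at most one; the cop may also walk back up,
   so [k] may exceed [i]. *)
suff H : forall k i, i <= k <= n -> below t (z i) -> ~ capt t a (p k).
  by apply: (H n n); rewrite !leqnn.
elim/(well_founded_ind (@below_wf B)): t => t IH [|k] i /andP[ik kn] tz.
  by move: ik tz; rewrite leqn0 => /eqP ->; apply: base.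
case=> [|/(_ a (Ncl_refl a)) [y [t' [/p_nbr]]]]; first exact: ap.
case=> // k' /andP[/= kk' k'n] -> t't.
case: i ik tz => [|i] ik tz; last first.
  apply: (IH t' t't k' i); first by rewrite k'n andbT; apply: leq_trans kk'.
  exact: below_successor (z_succ i (leq_trans ik kn)) tz t't.
apply: (IH t' t't k' 0); first by rewrite k'n.
exact: below_trans t't tz.
Qed.

Lemma path_climb :
  (forall k, k < n -> Ncl (p k.+1) (p k)) ->
  (forall i, i < n -> below (z i) (z i.+1)) ->
  (forall u, capt (z 0) u (p 0)) ->
  forall k, k <= n -> forall u, capt (z k) u (p k).
Proof.
move=> p_step z_incr base; elim=> [//|k IH] kn u.
apply: capt_step => x _; exists (p k), (z k).
by split; [exact: p_step|exact: z_incr|apply: IH; exact: ltnW].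
Qed.

End PathInGraph.

(** * Finite ordinals: paths *)

Section PathGraph.
Variable n : nat.

Let path_adj (i j : 'I_n.+1) : Prop := i.+1 = j :> nat \/ j.+1 = i :> nat.

Let path_adj_sym i j : path_adj i j -> path_adj j i.
Proof. by case; [right|left]. Qed.

Let path_adj_irr i : ~ path_adj i i.
Proof. by case=> /eqP; rewrite eqn_leq ltnn. Qed.

Definition path_graph : graph := MkGraph path_adj_sym path_adj_irr.

End PathGraph.

Lemma path_graph_capture (B : Ord) (n : nat) (z : nat -> B) :
  (forall t, ~ below t (z 0)) ->
  (forall k, k < n -> is_successor (z k) (z k.+1)) ->
  exists G : graph,
    (forall u v : G, capt (z n) u v) /\
    exists a b : G, forall t, below t (z n) -> ~ capt t a b.
Proof.
move=> z0 z_succ; exists (path_graph n).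
have z_incr i : i < n -> below (z i) (z i.+1) by case/z_succ.
have z_mono i u v := @capt_mono_seq B (path_graph n) n z i u v z_incr.
(* [q] is the path read backwards, so that [path_chase] serves a robber on either side of the
   cop. *)
pose p k : path_graph n := inord k; pose q k : path_graph n := inord (n - k).
have pK (u : path_graph n) : p u = u by apply: inord_val.
have nbr (u x : path_graph n) : Ncl u x -> (u.-1 <= x) && (x <= u.+1).
  by case=> [->|[] /=]; lia.
have lt_ord (u : path_graph n) : u <= n by rewrite -ltnS.
have p_nbr j x : 0 < j <= n -> Ncl (p j) x -> exists2 j', j.-1 <= j' <= n & x = p j'.
  move=> /andP[_ jn] /nbr; rewrite /p inordK // => /andP[h _].
  by exists x; rewrite ?h /= ?inord_val.
have q_nbr j x : 0 < j <= n -> Ncl (q j) x -> exists2 j', j.-1 <= j' <= n & x = q j'.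
  move=> /andP[j0 jn] /nbr; rewrite /q inordK ?ltnS ?leq_subr // => /andP[_ h].
  exists (n - x); last by rewrite subKn // inord_val.
  by have := lt_ord x; lia.
split=> [u v|].
  case: (leqP v u) => uv.
    apply: (z_mono (n - v)); first exact: leq_subr.
    have := path_chase p_nbr _ z_incr (i := n - v) (j := u).
    rewrite subKn // !pK; apply; rewrite ?leq_subr ?uv ?lt_ord // => i lt_in.
    by right; left; rewrite !inordK // ltnW.
  apply: (z_mono v) => //.
  have := path_chase q_nbr _ z_incr (i := v) (j := n - u).
  rewrite /q !subKn // !inord_val; apply=> [i lt_in||] //.
    by right; right; rewrite !inordK; lia.
  by have := lt_ord v; lia.
(* Robber and cop start at opposite ends; the base case is void, as nothing lies below [z 0]. *)
exists (p 0), (p n); apply: (path_delay p_nbr z_succ) => [k /andP[k0 kn]|t /z0 //].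
by move/(congr1 val); rewrite /= !inordK // => k_0; move: k0; rewrite -k_0.
Qed.

(** * Limit ordinals *)

(* The robber's territory is a forest of nodes of ranks below the limit [l]
   where every node has, for every smaller rank, two children of that rank. A
   node carries the labels of its ancestors after its own; if the ranks do not
   decrease from the second label to the first, it has no parent. *)
Section LimitGraph.
Variables (B : Ord) (l : B) (n : nat).

Definition label : Type := ({t : B | below t l} * bool)%type.
Definition node : Type := (label * seq label)%type.

Definition rank (x : node) : B := sval x.1.1.

Definition parent (x y : node) : Prop := y.2 = x.1 :: x.2 /\ below (rank y) (rank x).

Lemma rank_lt (x : node) : below (rank x) l.
Proof. exact: (svalP x.1.1). Qed.

Lemma parent_fun (x x' y : node) : parent x y -> parent x' y -> x = x'.
Proof. by case: x x' => [e s] [e' s'] [/= Ey _] [/=]; rewrite Ey => -[-> ->]. Qed.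

Lemma parent_irr (x : node) : ~ parent x x.
Proof. by case=> _ /below_irr. Qed.

Definition root_node (t : B) (tl : below t l) : node := ((exist _ t tl, true), [::]).

Definition child (x : node) (t : B) (tl : below t l) (b : bool) : node :=
  ((exist _ t tl, b), x.1 :: x.2).

Lemma parent_child (x : node) (t : B) (tl : below t l) (b : bool) :
  below t (rank x) -> parent x (child x tl b).
Proof. by []. Qed.

(* [Guard (Some x)] covers the node [x] and its parent, and [Guard None] is
   where the path [Trail 0, ..., Trail n] is attached. *)
Inductive limit_vertex : Type :=
| Trail of 'I_n.+1
| Node of node
| Guard of option node.

Definition limit_arc (u v : limit_vertex) : Prop :=
  match u, v with
  | Trail i, Trail j => i.+1 = j :> nat
  | Trail i, Guard None => i = 0 :> nat
  | Node x, Node y => parent x y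
  | Node x, Guard (Some y) => x = y \/ parent x y
  | Guard o, Guard o' => o <> o'
  | _, _ => False
  end.

Let limit_adj u v := limit_arc u v \/ limit_arc v u.

Let limit_adj_sym u v : limit_adj u v -> limit_adj v u.
Proof. by case; [right|left]. Qed.

Let limit_adj_irr u : ~ limit_adj u u.
Proof.
have H : ~ limit_arc u u; last by case.
by case: u => [i|x|o] //=; [lia|exact: parent_irr].
Qed.

Definition limit_graph : graph := MkGraph limit_adj_sym limit_adj_irr.

Let trail (k : nat) : limit_graph := Trail (inord k).

Hypothesis l_limit : is_limit_or_zero l.
Hypothesis l_pos : exists t, below t l.

Lemma trail_nbr j (x : limit_graph) :
  0 < j <= n -> Ncl (trail j) x -> exists2 j', j.-1 <= j' <= n & x = trail j'.
Proof.
move=> /andP[j0 jn] H.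
have {H} : exists2 i : 'I_n.+1, x = Trail i & j.-1 <= i.
  case: H => [->|[]]; first by exists (inord j); rewrite // inordK //; lia.
    by case: x => [i|y|[y|]] //=; rewrite inordK // => H; [exists i => //; lia|lia].
  by case: x => [i|y|[y|]] //=; rewrite inordK // => H; exists i => //; lia.
move=> [i -> h]; exists i; last by rewrite /trail inord_val.
by rewrite h /= -ltnS.
Qed.

Lemma trail_step i : i < n -> Ncl (trail i) (trail i.+1).
Proof. by move=> lt_in; right; left; rewrite /= !inordK // ltnW. Qed.

Lemma guard_nbr (o o' : option node) : Ncl (Guard o : limit_graph) (Guard o').
Proof.
by case: (classic (o' = o)) => [->|H]; [left|right; right].
Qed.

(* From his guard the cop meets the robber's move to a child by moving to the
   guard of that child, and captures him after any other move. *)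
Lemma capt_guarded (x : node) (t : B) :
  below (rank x) t -> capt t (Node x : limit_graph) (Guard (Some x)).
Proof.
have [r Er] : exists r, r = rank x by exists (rank x).
elim/(well_founded_ind (@below_wf B)): r x t Er => r IH x t Er rt; subst r.
have win (y : limit_graph) : Ncl (Guard (Some x) : limit_graph) y -> exists y' t',
    [/\ Ncl (Guard (Some x) : limit_graph) y', below t' t & capt t' y y'].
  by move=> ?; exists y, (rank x); split=> //; apply: capt_eq.
apply: capt_step => y [->|[|]].
- by apply: win; right; right; left.
- case: y => // [y xy|[y|] // _]; last by apply: win; exact: guard_nbr.
  exists (Guard (Some y)), (rank x); split=> //; first exact: guard_nbr.
  by apply: (IH (rank y)) => //; case: xy.
- by case: y => // y yx; apply: win; right; right; right.
Qed.

(** Children have smaller rank, so only [x] and its unique parent matter, and the limit leaves room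
    above both. *)
Lemma node_rank_bound (x : node) :
  exists2 r, below r l &
    forall y, [\/ y = x, parent x y | parent y x] -> below (rank y) r.
Proof.
case: (classic (exists z, parent z x)) => [[z zx]|nz].
  have [r zr rl] := l_limit (rank_lt z); exists r => // y.
  case=> [->|[_ yx]|yx].
  - by apply: below_trans zr; case: zx.
  - by apply: below_trans yx (below_trans _ zr); case: zx.
  - by rewrite (parent_fun yx zx).
have [r xr rl] := l_limit (rank_lt x); exists r => // y.
case=> [-> //|[_ yx]|yx]; last by case: nz; exists y.
exact: below_trans yx xr.
Qed.

(** If the robber stays on the trail, the cop enters at [trail 0] and chases him to the end; if he
    steps onto a guard, the clique gives immediate capture. *)
Lemma capt_trail :
  exists2 r, below r l & forall i, capt r (Trail i : limit_graph) (Guard None).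
Proof.
have [t0 t0l] := l_pos; have [w wP] := limit_chain l_limit t0l.
exists (w n.+1) => [|i]; first by case: (wP n.+1).
apply: capt_step => x ix; exists (if x is Trail _ then trail 0 else x), (w n).
split; last 2 [by case: (wP n)].
- case: x ix => [j|x|o] ix; last exact: guard_nbr; last by case: ix => [|[]].
  by right; right; rewrite /= inordK.
- case: x ix => [j|x|o] _; try exact: capt_eq.
  have := path_chase trail_nbr trail_step (z := w) _ (i := n) (j := j).
  rewrite subnn /trail inord_val; apply=> // [i' _|]; first by case: (wP i').
  by rewrite /= -ltnS.
Qed.

(** The bound [r] is uniform over the robber's moves from [u]: the nodes in reach have bounded rank,
    and the trail has a single bound. *)
Lemma guard_reply (u : limit_graph) :
  exists2 r, below r l &
    forall x, Ncl u x -> exists o, capt r x (Guard o : limit_graph).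
Proof.
have [r0 r0l cr0] := capt_trail.
have node_case z :
    (forall y, Ncl u (Node y : limit_graph) -> [\/ y = z, parent z y | parent y z]) ->
    (forall i, ~ Ncl u (Trail i : limit_graph)) ->
    exists2 r, below r l & forall x, Ncl u x -> exists o, capt r x (Guard o : limit_graph).
  move=> uz ut; have [r rl rP] := node_rank_bound z; exists r => //.
  case=> [i /ut //|y /uz /rP yr|o _]; last by exists o; apply: capt_eq.
  by exists (Some y); apply: capt_guarded.
have trail_case : (forall y, ~ Ncl u (Node y : limit_graph)) ->
    exists2 r, below r l & forall x, Ncl u x -> exists o, capt r x (Guard o : limit_graph).
  move=> uy; exists r0 => //; case=> [i _|y /uy //|o _]; first by exists None.
  by exists o; apply: capt_eq.
case: u node_case trail_case => [i _ tc|z nc _|[z nc _|_ tc]].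
- by apply: tc => y [|[]].
- apply: (nc z) => [y [[->]|[]]|i [|[]]] //; by [apply: Or31|apply: Or32|apply: Or33].
- apply: (nc z) => [y [//|[//|[]]]|i [|[]]] //; by [apply: Or31|apply: Or33].
- by apply: tc => y [|[]].
Qed.

Lemma capt_from_guard (o : option node) (u : limit_graph) :
  exists2 t, below t l & capt t u (Guard o : limit_graph).
Proof.
have [r rl rP] := guard_reply u; have [t rt tl] := l_limit rl; exists t => //.
apply: capt_step => x /rP [o' c]; exists (Guard o'), r; split=> //.
exact: guard_nbr.
Qed.

(** Each robber position has a bound below [l] once the cop is on a guard; getting there costs one
    move, whence level [l]. *)
Lemma capt_near_guard (u v : limit_graph) (o : option node) :
  Ncl v (Guard o : limit_graph) -> capt l u v.
Proof.
move=> vo; apply: capt_step => x _; have [t tl c] := capt_from_guard o x.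
by exists (Guard o), t.
Qed.

(* Of the two children of a given rank, at most one is in the reach of the
   cop. *)
Lemma free_child (x : node) (v : limit_graph) (t : B) (tl : below t l) :
  v <> Node x -> below t (rank x) ->
  exists b, ~ Ncl v (Node (child x tl b) : limit_graph).
Proof.
move=> vx tx.
case: (classic (Ncl v (Node (child x tl true) : limit_graph))) => [h|]; last by exists true.
case: (classic (Ncl v (Node (child x tl false) : limit_graph))) => [h'|]; last by exists false.
exfalso.
have par b := @parent_child x t tl b tx.
(* The two siblings differ in their flag, have equal rank, and a node has only one parent. *)
have key (y : node) : child x tl true = y \/ parent (child x tl true) y ->
    child x tl false = y \/ parent (child x tl false) y -> False.
  case=> [<-|py] [E|py'].
  - by [].
  - by case: py' => _ /below_irr.
  - by move: py; rewrite -E => -[_ /below_irr].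
  - by have := parent_fun py py'.
case: v vx h h' => [i|y|[y|]] vx.
- by case=> [//|[]].
- have only b : Ncl (Node y : limit_graph) (Node (child x tl b)) ->
      child x tl b = y \/ parent (child x tl b) y.
    case=> [[->]|[/= h|]]; [by left| |by right].
    by case: vx; rewrite (parent_fun h (par b)).
  by move=> /only h /only; exact: key h.
- by case=> [//|[//|h]] [//|[//|]]; exact: key h.
- by case=> [//|[]].
Qed.

(** The robber moves to a free child of rank exactly [t], which still exceeds every time left after
    that round. *)
Lemma not_capt_node (x : node) (v : limit_graph) (t : B) :
  v <> Node x -> below t (rank x) -> ~ capt t (Node x : limit_graph) v.
Proof.
elim/(well_founded_ind (@below_wf B)): t x v => t IH x v vx tx.
have tl := below_trans tx (rank_lt x).
case=> [E|H]; first by case: vx.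
have [b nb] := free_child tl vx tx.
have [y [t' [vy t't]]] : exists y t',
    [/\ Ncl v y, below t' t & capt t' (Node (child x tl b) : limit_graph) y].
  by apply: H; right; left.
by apply: IH => // E; apply: nb; rewrite -E.
Qed.

(** Knowing [t], the robber goes through the guard of a root of rank [t] to that root, while the cop
    is still too far away to reach it. *)
Lemma not_capt_trail0 (t : B) :
  below t l -> ~ capt t (Guard None : limit_graph) (trail 0).
Proof.
move=> tl [//|H]; pose x := root_node tl.
have [y [t' [yP t't]]] := H (Guard (Some x)) (guard_nbr _ _).
have {}yP : (exists i, y = Trail i) \/ y = Guard None.
  case: yP => [->|[]]; first by left; exists (inord 0).
    by case: y => // [i _|[]] //; [left; exists i|right].
  by case: y => // i _; left; exists i.
case=> [E|{}H]; first by case: yP => [[i Ei]|Ei]; rewrite Ei in E.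
have [|y' [t'' [y'P t''t' ]]] := H (Node x); first by right; right; left.
apply: not_capt_node; last exact: below_trans t''t' t't.
by move=> Ey'; case: yP y'P => [[i ->]|->]; rewrite Ey' => -[|[]].
Qed.

Lemma limit_graph_capture (z : nat -> B) :
  z 0 = l -> (forall k, k < n -> is_successor (z k) (z k.+1)) ->
  (forall u v : limit_graph, capt (z n) u v) /\
  exists a b : limit_graph, forall t, below t (z n) -> ~ capt t a b.
Proof.
move=> z0 z_succ.
have z_incr i : i < n -> below (z i) (z i.+1) by case/z_succ.
split=> [u v|].
  have near w o : Ncl (w : limit_graph) (Guard o : limit_graph) -> capt (z n) u w.
    (* Guards and nodes cost at most [z 0]; only the trail needs the later levels. *)
    move/(capt_near_guard u) => c; apply: (capt_mono_seq z_incr (leq0n n)).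
    by rewrite z0.
  case: v => [i|x|o]; last exact: (near _ o (Ncl_refl _)); last first.
    by apply: (near _ (Some x)); right; left; left.
  have le_in : i <= n by rewrite -ltnS.
  apply: (capt_mono_seq z_incr le_in).
  have -> : Trail i = trail i by rewrite /trail inord_val.
  apply: (@path_climb _ _ n trail z _ z_incr _ _ le_in) => [k kn|w].
    by right; right; rewrite /= !inordK // ltnW.
  rewrite z0; apply: (@capt_near_guard _ _ None); right; left.
  by rewrite /= inordK.
exists (Guard None), (trail n); apply: (path_delay trail_nbr z_succ) => //.
by rewrite z0; exact: not_capt_trail0.
Qed.

End LimitGraph.

Lemma exists_graph_level (B : Ord) (t : B) :
  exists G : graph,
    (forall u v : G, capt t u v) /\
    exists a b : G, forall s, below s t -> ~ capt s a b.
Proof.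
have [z [n [<- z0 z_succ]]] := successor_decomposition t.
case: (classic (exists s, below s (z 0))) => [z_pos|nz].
  by exists (limit_graph (z 0) n); apply: limit_graph_capture.
by apply: path_graph_capture => // s sz; apply: nz; exists s.
Qed.

(** * The maximum capture time *)

Section Top.
Variable a : Ord.

Let top_below (u v : option a) : Prop :=
  match u, v with
  | Some x, Some y => below x y
  | Some _, None => True
  | None, _ => False
  end.

Let top_trans u v w : top_below u v -> top_below v w -> top_below u w.
Proof. by case: u v w => [x|] [y|] [z|] //=; apply: below_trans. Qed.

Let top_total u v : [\/ top_below u v, u = v | top_below v u].
Proof.
case: u v => [x|] [y|] /=; [|exact: Or31|exact: Or33|exact: Or32].
by case: (below_total x y) => [h|->|h]; [apply: Or31|apply: Or32|apply: Or33].
Qed.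

Let top_wf : well_founded top_below.
Proof.
have H x : Acc top_below (Some x).
  elim/(well_founded_ind (@below_wf a)): x => x IH.
  by constructor; case=> [y /IH|].
by case=> [//|]; constructor; case.
Qed.

(** The new largest element [None] represents the ordinal [a] itself, which makes [capt] applicable
    at level [a]. *)
Definition ord_top : Ord := MkOrd top_trans top_total top_wf.

Lemma iso_seg_top : iso_seg a (None : ord_top).
Proof.
exists (fun x => Some x : ord_top); split=> [x y //|[z|]]; split=> //.
- by exists z.
- by case.
Qed.

End Top.

Lemma is_eta_exists (B : Ord) (G : graph) (t : B) (v : G) :
  (forall u, capt t u v) -> exists b, is_eta v b.
Proof.
move=> tv; have [s [sv sm]] := exists_minimal (ex_intro (fun t => forall u, capt t u v) t tv).
exists (seg s); split=> [u|b bv]; first by apply/rel_leP; [exact: iso_seg_seg|].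
case: (ord_le_or_lt (seg s) b) => // /iso_seg_lt /(_ (iso_seg_seg s)) [r rs br].
by case: (sm r rs) => u; apply/(rel_leP _ _ br).
Qed.

(** One slow pair suffices: a smaller bound on all capture times would put the capture time of [b]
    below [None], against the second hypothesis. *)
Lemma is_rho_capt (alpha : Ord) (G : graph) (a b : G) :
  (forall u v : G, capt (None : ord_top alpha) u v) ->
  (forall s : ord_top alpha, below s None -> ~ capt s a b) ->
  is_rho G alpha.
Proof.
move=> up low; have top := iso_seg_top alpha; split=> [v|v e [_ em]|c cP].
- exact: is_eta_exists (up^~ v).
- by apply: em => u; apply/(rel_leP _ _ top).
case: (ord_le_or_lt alpha c) => // /iso_seg_lt /(_ top) [r rN cr].
have [e ev] := is_eta_exists (up^~ b).
have [s sN es] : exists2 s : ord_top alpha, below s None & iso_seg e s.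
  case: (cP b e ev) => [/iso_seg_lt /(_ cr) [s sr es]|ec].
    by exists s => //; exact: below_trans sr rN.
  by exists r => //; exact: iso_seg_eq ec cr.
by case: (low s sN); apply/(rel_leP _ _ es); case: ev.
Qed.

(* The cop always moves to a vertex from which the capture time is least, so
   the capture time decreases until the capture. *)
Lemma cop_win_capt (B : Ord) (G : graph) (t : B) (v0 : G) :
  (forall u v : G, capt t u v) -> cop_win G.
Proof.
move=> up.
(* A reply attaining the least level is as good as any other reply at every level. *)
have /choice [f fP] (vx : G * G) : exists y, Ncl vx.1 y /\
    forall (s : B) y', Ncl vx.1 y' -> capt s vx.2 y' -> capt s vx.2 y.
  case: vx => v x /=.
  have [s [[y [vy sy]] sm]] := exists_minimal
    (ex_intro (fun s => exists y, Ncl v y /\ capt s x y) t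
      (ex_intro _ v (conj (Ncl_refl v) (up x v)))).
  exists y; split=> // s' y' vy' s'y'.
  case: (below_total s s') => [/capt_mono|<- //|/sm []]; first exact.
  by exists y'.
(* The cop's position is recomputed from [v0] and the robber's history. *)
pose strat := foldl (fun v x => f (v, x)) v0.
exists strat => r r_move; pose c := cop_play strat r.
have cS n : c n.+1 = f (c n, r n).
  by rewrite /c /cop_play /strat /mkseq -addn1 iotaD map_cat foldl_cat.
split=> [n|]; first by rewrite -/(c n.+1) cS; case: (fP (c n, r n)).
suff H (s : B) n : capt s (r n) (c n.+1) -> exists m, c m.+1 = r m.
  exact: (H t 0 (up _ _)).
elim/(well_founded_ind (@below_wf B)): s n => s IH n.
case=> [E|/(_ _ (r_move n)) [y [s' [cy s's h]]]]; first by exists n.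
apply: (IH s' s's n.+1); rewrite (cS n.+1).
by have [_] := fP (c n.+1, r n.+1); apply; first exact: cy.
Qed.

Theorem theorem16 (alpha : Ord) :
  exists G : graph, cop_win G /\ is_rho G alpha.
Proof.
have [G [up [a [b low]]]] := exists_graph_level (None : ord_top alpha).
by exists G; split; [exact: cop_win_capt a up|exact: is_rho_capt up low].
Qed.
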